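(* Work in the work extraction game described in the context. Let $\rho$ and $\sigma$ be states on the same number $d=2n+1$ of levels. Assume that each of $\rho$ and $\sigma$ has at least $n+1$ levels with occupation probability $0$ and energy $+\infty$. Let $\varepsilon\in[0,1)$. Then the bound $W^\varepsilon(\rho\to\sigma)$ is achievable in the following sense. For every $\delta>0$ there is a strategy, starting from $\rho$ and ending with the energies of $\sigma$, such that: - with probability at least $1-\varepsilon-\delta$, the total extracted work satisfies $W_{\rm tot}\ge W^\varepsilon(\rho\to\sigma)-\delta$; - conditioned on this event, the distribution of the final occupied level is within total variation distance $\delta$ of the occupation probabilities of $\sigma$. (The paper constructs an explicit protocol realising this as a limit.)
   Context: Conventions. The constants $k>0$ (Boltzmann's constant) and $T>0$ (temperature) are fixed. A state is a finite-level system with energies $E_1,\dots,E_d\in\mathbb{R}\cup\{+\infty\}$, not all $+\infty$, together with a diagonal density matrix $\rho=\sum_i\lambda_i|e_i\rangle\langle e_i|$. Equivalently, it is a probability vector $(\lambda_i)$ over the levels, and we require $\lambda_i=0$ whenever $E_i=+\infty$. Gibbs rescaling. $G^T(\rho)$ is the function on $[0,\infty)$ built as follows. Each level $i$ with $E_i<\infty$ is represented by a block: an interval of length $e^{-E_i/kT}$ on which the function takes the constant value $\lambda_i e^{E_i/kT}$, so the block has area $\lambda_i$. The blocks are placed consecutively starting at $0$, in order of nonincreasing height. The function is $0$ beyond $Z=\sum_{i:E_i<\infty}e^{-E_i/kT}$. Thus $G^T(\rho)$ is a nonincreasing probability density supported in $[0,Z]$. Relative mixedness. For nonincreasing integrable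 functions $f,g\ge 0$ on $[0,\infty)$, $$M(f\|g):=\max\Big\{m>0:\ \int_0^l f(x)\,dx\ge\int_0^{lm}g(x)\,dx\ \text{for all } l\ge 0\Big\}.$$ For $\varepsilon\in[0,1)$ define $$W^\varepsilon(\rho\to\sigma):=kT\ln M\big(G^T(\rho)/(1-\varepsilon)\,\big\|\,G^T(\sigma)\big).$$ Work extraction game. - A working medium has levels $1,\dots,d$. At each time it has an energy assignment $E\in(\mathbb{R}\cup\{+\infty\})^d$ and occupies exactly one (random) level. - For an assignment $E$, the Gibbs vector is $\gamma_E(i)=e^{-E_i/kT}/\sum_j e^{-E_j/kT}$, which is $0$ for levels at $+\infty$. - A strategy is a finite sequence of elementary steps, fixed in advance and independent of the random outcomes. Each step is one of two kinds. - (i) Thermalisation. Choose a $d\times d$ column-stochastic matrix $B$ with $B\gamma_E=\gamma_E$ for the current energies $E$. If the current level is $j$, the new level is $i$ with probability $B_{ij}$. Energies are unchanged and no work is exchanged. - (ii) Energy change. Choose a set $S$ of levels and new values for the energies of the levels in $S$; the other energies are unchanged and the occupied level is unchanged. If the occupied level $i$ lies in $S$, the work reservoir receives extracted work $E_i^{\rm old}-E_i^{\rm new}$; otherwise it receives $0$. (The paper changes all levels in $S$ by a common amount; arbitrary changes are compositions of such steps.) - The total extracted work $W_{\rm tot}$ is the sum over steps. By convention, a realisation in which some step yields work $-\infty$ (an occupied level raised to $+\infty$) has $W_{\rm tot}=-\infty$. - The initial energies are those of $\rho$ and the initial occupied level is distributed according to $\rho$'s occupation probabilities. *)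

(* Defs.v *)
From Stdlib Require Import Reals Lra List.
Import ListNotations.
Open Scope R_scope.

(** Extended energies: [Some e] = finite energy e, [None] = +infinity. *)
Definition Energies := nat -> option R.

Definition sumd (d : nat) (f : nat -> R) : R :=
  fold_right Rplus 0 (map f (seq 0 d)).

Record State := mkState { En : Energies ; lam : nat -> R }.

Definition IsState (d : nat) (s : State) : Prop :=
  (forall i, (i < d)%nat -> 0 <= lam s i) /\
  sumd d (lam s) = 1 /\
  (forall i, (i < d)%nat -> En s i = None -> lam s i = 0) /\
  (exists i, (i < d)%nat /\ En s i <> None).

Definition boltz (k T : R) (e : option R) : R :=
  match e with Some x => exp (- x / (k * T)) | None => 0 end.

(** Width of the block of level i (0 for levels at +infinity, which have no block). *)
Definition blk_w (k T : R) (s : State) (i : nat) : R := boltz k T (En s i).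
Definition blk_h (k T : R) (s : State) (i : nat) : R :=
  match En s i with Some x => lam s i * exp (x / (k * T)) | None => 0 end.
(** Left end of the block of level i: blocks are placed consecutively from 0 in
    order of nonincreasing height (ties broken by level index). *)
Definition blk_start (k T : R) (d : nat) (s : State) (i : nat) : R :=
  sumd d (fun j =>
    if Rgt_dec (blk_h k T s j) (blk_h k T s i) then blk_w k T s j
    else if Req_EM_T (blk_h k T s j) (blk_h k T s i) then
      (if Nat.ltb j i then blk_w k T s j else 0)
    else 0).
(** G^T(rho) as a function of x (it is 0 for x < 0 and for x beyond Z). *)
Definition GibbsResc (k T : R) (d : nat) (s : State) (x : R) : R :=
  sumd d (fun i =>
    if Rle_dec (blk_start k T d s i) x then
      if Rlt_dec x (blk_start k T d s i + blk_w k T s i) then blk_h k T s i else 0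
    else 0).

Definition MixCond (f g : R -> R) (m : R) : Prop :=
  forall l, 0 <= l ->
    exists (pf : Riemann_integrable f 0 l) (pg : Riemann_integrable g 0 (l * m)),
      RiemannInt pf >= RiemannInt pg.

Definition IsRelMix (f g : R -> R) (M : R) : Prop :=
  0 < M /\ MixCond f g M /\ (forall m, 0 < m -> MixCond f g m -> m <= M).

Definition gibbs_vec (k T : R) (d : nat) (E : Energies) (i : nat) : R :=
  boltz k T (E i) / sumd d (fun j => boltz k T (E j)).

Inductive Step :=
| Therm (B : nat -> nat -> R)                        (* B i j = prob. j -> i *)
| EChange (Sset : nat -> bool) (Enew : nat -> option R).

Definition apply_E (st : Step) (E : Energies) : Energies :=
  match st with
  | Therm _ => E
  | EChange Sset Enew => fun i => if Sset i then Enew i else E i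
  end.

Definition valid_step (k T : R) (d : nat) (E : Energies) (st : Step) : Prop :=
  match st with
  | Therm B =>
      (forall i j, (i < d)%nat -> (j < d)%nat -> 0 <= B i j) /\
      (forall j, (j < d)%nat -> sumd d (fun i => B i j) = 1) /\
      (forall i, (i < d)%nat ->
         sumd d (fun j => B i j * gibbs_vec k T d E j) = gibbs_vec k T d E i)
  | EChange _ _ => True
  end.

Fixpoint ValidStrategy (k T : R) (d : nat) (E : Energies) (l : list Step) : Prop :=
  match l with
  | nil => True
  | st :: l' => valid_step k T d E st /\ ValidStrategy k T d (apply_E st E) l'
  end.

Fixpoint final_E (E : Energies) (l : list Step) : Energies :=
  match l with nil => E | st :: l' => final_E (apply_E st E) l' end.

(** Work values: [Some w] finite, [None] = -infinity. *)
Definition work_of (Eold Enew : option R) : option R :=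
  match Eold, Enew with
  | Some a, Some b => Some (a - b)
  | Some _, None => None
  | None, _ => None  (* only reachable with probability 0 or after a -oo step *)
  end.

Definition addw (w1 w2 : option R) : option R :=
  match w1, w2 with Some a, Some b => Some (a + b) | _, _ => None end.

Record Outcome := mkOut { o_p : R ; o_lvl : nat ; o_w : option R }.

Definition step_out (d : nat) (E : Energies) (st : Step) (o : Outcome) : list Outcome :=
  match st with
  | Therm B =>
      map (fun i => mkOut (o_p o * B i (o_lvl o)) i (o_w o)) (seq 0 d)
  | EChange Sset Enew =>
      [mkOut (o_p o) (o_lvl o)
        (if Sset (o_lvl o) then addw (o_w o) (work_of (E (o_lvl o)) (Enew (o_lvl o)))
         else o_w o)]
  end.

Fixpoint run (d : nat) (E : Energies) (outs : list Outcome) (l : list Step)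
  : list Outcome :=
  match l with
  | nil => outs
  | st :: l' => run d (apply_E st E) (flat_map (step_out d E st) outs) l'
  end.

Definition init_outs (d : nat) (s : State) : list Outcome :=
  map (fun i => mkOut (lam s i) i (Some 0)) (seq 0 d).

Definition in_event (thr : R) (w : option R) : bool :=
  match w with Some x => if Rle_dec thr x then true else false | None => false end.

Definition prob_event (outs : list Outcome) (thr : R) : R :=
  fold_right Rplus 0 (map (fun o => if in_event thr (o_w o) then o_p o else 0) outs).

Definition prob_event_lvl (outs : list Outcome) (thr : R) (i : nat) : R :=
  fold_right Rplus 0
    (map (fun o => if andb (in_event thr (o_w o)) (Nat.eqb (o_lvl o) i) then o_p o else 0) outs).

Definition cond_TV (d : nat) (outs : list Outcome) (thr : R) (q : nat -> R) : R :=
  / 2 * sumd d (fun i => Rabs (prob_event_lvl outs thr i / prob_event outs thr - q i)).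

Definition AtLeastInfLevels (d m : nat) (s : State) : Prop :=
  exists l : list nat, NoDup l /\ (m <= length l)%nat /\
    forall i, In i l -> (i < d)%nat /\ En s i = None /\ lam s i = 0.

(* Main.v *)
(** Let w_i = exp(-E_i/kT) be the block widths and h_i the block heights. A single
    Gibbs-stochastic matrix already realises the optimal conversion, so no
    quasi-static limit is needed and the bound is attained exactly.

    By conjugacy of the Lorenz curve with [t |-> sum_i w_i (h_i - t)_+], the mixing
    condition at [M] says that [(1 - eps) sigma], with all energies raised by
    [kT ln M], is weakly submajorised relative to the widths by [rho]. This gives
    a transport plan from the levels of rho to those of sigma, built by serving
    each target height from the two remaining source heights next to it: no
    remaining source lies strictly between these two, so domination survives.
    Completing the plan to a Gibbs-stochastic matrix uses that the target levels are
    empty, hence that their columns are free. The mass [eps] left outside the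
    support of sigma is raised to +infinity, and lowering the levels of sigma by
    [kT ln M] yields that work with certainty. The levels at +infinity serve to first
    move rho off the support of sigma: there are enough of them for an involution
    of the levels exchanging the common finite levels with common infinite ones. *)

Require Import Defs.
From Stdlib Require Import Reals List Lra Lia Arith Psatz Classical.
From Coquelicot Require Import Coquelicot.
Open Scope R_scope.

(** * Finite sums *)

Lemma sumd_S d f : sumd (S d) f = sumd d f + f d.
Proof.
unfold sumd. rewrite seq_S, map_app, fold_right_app. cbn [map fold_right].
rewrite Nat.add_0_l, Rplus_0_r.
generalize (map f (seq 0 d)); intro l.
induction l as [|x l IH]; simpl; [ring | rewrite IH; ring].
Qed.

Lemma sumd_ext d f g : (forall i, (i < d)%nat -> f i = g i) -> sumd d f = sumd d g.
Proof.
induction d as [|d IH]; intro H; [reflexivity|].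
rewrite !sumd_S, IH, H; auto.
Qed.

Lemma sumd_le d f g : (forall i, (i < d)%nat -> f i <= g i) -> sumd d f <= sumd d g.
Proof.
induction d as [|d IH]; intro H; [apply Rle_refl|].
rewrite !sumd_S. apply Rplus_le_compat; auto.
Qed.

Lemma sumd_plus d f g : sumd d (fun i => f i + g i) = sumd d f + sumd d g.
Proof. induction d as [|d IH]; [unfold sumd; simpl; ring|]. rewrite !sumd_S, IH; ring. Qed.

Lemma sumd_minus d f g : sumd d (fun i => f i - g i) = sumd d f - sumd d g.
Proof. induction d as [|d IH]; [unfold sumd; simpl; ring|]. rewrite !sumd_S, IH; ring. Qed.

Lemma sumd_scal d c f : sumd d (fun i => c * f i) = c * sumd d f.
Proof. induction d as [|d IH]; [unfold sumd; simpl; ring|]. rewrite !sumd_S, IH; ring. Qed.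

Lemma sumd_0 d : sumd d (fun _ => 0) = 0.
Proof. induction d as [|d IH]; [reflexivity|]. rewrite sumd_S, IH; ring. Qed.

Lemma sumd_eq0 d f : (forall i, (i < d)%nat -> f i = 0) -> sumd d f = 0.
Proof. intro H. rewrite <- (sumd_0 d). now apply sumd_ext. Qed.

Lemma sumd_ge0 d f : (forall i, (i < d)%nat -> 0 <= f i) -> 0 <= sumd d f.
Proof. intro H. rewrite <- (sumd_0 d). now apply sumd_le. Qed.

Lemma sumd_exch d e f :
  sumd d (fun i => sumd e (fun j => f i j)) = sumd e (fun j => sumd d (fun i => f i j)).
Proof.
induction d as [|d IH]; [unfold sumd at 1; simpl; symmetry; apply sumd_0|].
rewrite sumd_S, IH, <- sumd_plus. apply sumd_ext; intros. now rewrite sumd_S.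
Qed.

Lemma sumd_delta d a f :
  (a < d)%nat -> sumd d (fun i => if Nat.eqb i a then f i else 0) = f a.
Proof.
induction d as [|d IH]; intro H; [lia|]. rewrite sumd_S.
destruct (Nat.eq_dec a d) as [->|Hne].
- rewrite Nat.eqb_refl, sumd_eq0; [ring|].
  intros i Hi. now rewrite (proj2 (Nat.eqb_neq i d)) by lia.
- rewrite (proj2 (Nat.eqb_neq d a)), IH by lia. ring.
Qed.

Lemma sumd_ge_term d f a :
  (forall i, (i < d)%nat -> 0 <= f i) -> (a < d)%nat -> f a <= sumd d f.
Proof.
intros H Ha. rewrite <- (sumd_delta d a f Ha). apply sumd_le. intros i Hi.
destruct (Nat.eqb i a); [lra|auto].
Qed.

Lemma sumd_pos_term d f :
  0 < sumd d f -> exists i, (i < d)%nat /\ 0 < f i.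
Proof.
induction d as [|d IH]; [unfold sumd; simpl; lra|]. rewrite sumd_S. intro H.
destruct (Rlt_dec 0 (f d)) as [Hd|Hd]; [exists d; auto|].
destruct IH as [i [Hi Hf]]; [lra|]. exists i; split; [lia|auto].
Qed.

Lemma sumd_invol d (pi : nat -> nat) f :
  (forall i, pi (pi i) = i) -> (forall i, (i < d)%nat -> (pi i < d)%nat) ->
  sumd d (fun i => f (pi i)) = sumd d f.
Proof.
intros Hinv Hlt.
transitivity (sumd d (fun i => sumd d (fun j => if Nat.eqb j (pi i) then f j else 0))).
{ apply sumd_ext; intros i Hi. symmetry. apply (sumd_delta d (pi i)); auto. }
rewrite sumd_exch. apply sumd_ext; intros j Hj.
transitivity (sumd d (fun i => if Nat.eqb i (pi j) then f j else 0));
  [|apply (sumd_delta d (pi j) (fun _ => f j)); auto].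
apply sumd_ext; intros i Hi.
replace (Nat.eqb i (pi j)) with (Nat.eqb j (pi i)); [reflexivity|].
apply Bool.eq_iff_eq_true. rewrite !Nat.eqb_eq. split; intros ->; now rewrite Hinv.
Qed.

(** * Weak submajorisation and transport plans *)

Definition ppart (x : R) : R := Rmax 0 x.

Lemma ppart_ge0 x : 0 <= ppart x.
Proof. apply Rmax_l. Qed.

Lemma ppart_ge x : x <= ppart x.
Proof. apply Rmax_r. Qed.

Lemma ppart_of_ge x : 0 <= x -> ppart x = x.
Proof. apply Rmax_right. Qed.

Lemma ppart_of_le x : x <= 0 -> ppart x = 0.
Proof. apply Rmax_left. Qed.

Lemma ppart_convex r x y : 0 <= r <= 1 ->
  ppart (r * x + (1 - r) * y) <= r * ppart x + (1 - r) * ppart y.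
Proof.
intros Hr. unfold ppart. apply Rmax_lub; unfold Rmax; repeat destruct Rle_dec; nra.
Qed.

(** Maxima are obtained by passing [- h]. Ties go to the smallest index, matching the tie-breaking
    of [blk_start]; [top_block] relies on this. *)
Lemma first_argmin d (P : nat -> Prop) (h : nat -> R) :
  (exists a, (a < d)%nat /\ P a /\
     forall i, (i < d)%nat -> P i -> h a < h i \/ (h a = h i /\ (a <= i)%nat)) \/
  (forall i, (i < d)%nat -> ~ P i).
Proof.
induction d as [|d [[a [Ha [Pa Hmin]]]|Hn]]; [right; lia| |];
  destruct (classic (P d)) as [Pd|nPd].
- left. destruct (Rle_dec (h a) (h d)) as [Had|Had].
  + exists a; split; [lia|split; auto]. intros j Hj Pj.
    destruct (Nat.eq_dec j d) as [->|]; [|apply Hmin; auto; lia].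
    destruct Had; [left; auto|right; split; auto; lia].
  + exists d; split; [lia|split; auto]. intros j Hj Pj.
    destruct (Nat.eq_dec j d) as [->|]; [right; auto|].
    destruct (Hmin j); auto; [lia|lra|lra].
- left. exists a; split; [lia|split; auto]. intros j Hj Pj.
  destruct (Nat.eq_dec j d) as [->|]; [contradiction|apply Hmin; auto; lia].
- left. exists d; split; [lia|split; auto]. intros j Hj Pj.
  destruct (Nat.eq_dec j d) as [->|]; [right; auto|]. exfalso; apply (Hn j); auto; lia.
- right. intros j Hj. destruct (Nat.eq_dec j d) as [->|]; [auto|apply Hn; lia].
Qed.

(** Takes [t] as large as the three capacities allow; the last disjunction records which one is
    exhausted. For [r = 1] the capacity [y] imposes nothing, hence the guard [r < 1]. *)
Lemma max_scale v x y r :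
  0 < v -> 0 <= x -> 0 <= y -> 0 < r <= 1 ->
  exists t, 0 <= t <= v /\ t * r <= x /\ t * (1 - r) <= y /\
    (t = v \/ t * r = x \/ (r < 1 /\ t * (1 - r) = y)).
Proof.
intros Hv Hx Hy Hr.
assert (H1 : exists t, 0 <= t <= v /\ t * r <= x /\ (t = v \/ t * r = x)).
{ destruct (Rle_dec (v * r) x) as [H|H]; [exists v; split; [lra|auto]|].
  exists (x / r). assert (E : x / r * r = x) by (field; lra).
  assert (0 <= x / r) by (apply Rdiv_le_0_compat; lra).
  split; [split; [auto|nra]|split; [lra|auto]]. }
destruct H1 as [t [Ht [Hx' Hor]]].
destruct (Rle_dec (t * (1 - r)) y) as [H|H]; [exists t; tauto|].
assert (r < 1) by (apply Rnot_le_lt; intro; replace r with 1 in H by lra; lra).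
exists (y / (1 - r)). assert (E : y / (1 - r) * (1 - r) = y) by (field; lra).
assert (0 <= y / (1 - r)) by (apply Rdiv_le_0_compat; lra).
assert (y / (1 - r) <= t) by nra.
split; [lra|split; [nra|split; [lra|auto]]].
Qed.

(* The mean [g] is produced from the two occupied heights nearest to it on
   either side; if there is none below, a reservoir of height [0] is used. *)
Lemma two_point_window d (w h : nat -> R) v g :
  (forall j, (j < d)%nat -> 0 <= w j) -> (forall j, (j < d)%nat -> 0 <= h j) ->
  0 < v -> 0 < g -> (exists j, (j < d)%nat /\ 0 < w j /\ g <= h j) ->
  exists t (kap : nat -> R) hb ha,
    0 <= hb /\ hb < g <= ha /\ 0 <= t <= v /\
    (forall j, (j < d)%nat -> 0 < w j -> h j <= hb \/ ha <= h j) /\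
    (forall j, (j < d)%nat -> 0 <= kap j <= w j) /\
    sumd d kap <= t /\
    (forall s, 0 <= s <= hb \/ ha <= s ->
       sumd d (fun j => kap j * ppart (h j - s)) = t * ppart (g - s)) /\
    (t = v \/ exists j, (j < d)%nat /\ 0 < w j /\ kap j = w j).
Proof.
intros Hw Hh Hv Hg [j0 [Hj0 [Wj0 Gj0]]].
destruct (first_argmin d (fun j => 0 < w j /\ g <= h j) h) as [[a [Ha [[Wa Ga] Hmin]]]|Hn];
  [|exfalso; apply (Hn j0); auto].
assert (Hmin' : forall j, (j < d)%nat -> 0 < w j -> g <= h j -> h a <= h j)
  by (intros j Hj Wj Gj; destruct (Hmin j Hj); [tauto|lra|lra]).
clear Hmin.
(* The flag [e] is 1 if the lower partner is the level [b] and 0 if it is the reservoir. The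
   reservoir gets capacity [v], which is never the one exhausted: [r > 0] gives
   [t * (1 - r) < v]. *)
assert (Hb : exists (b : nat) (e wb hb : R), (b < d)%nat /\ 0 <= wb /\ 0 <= hb < g /\
    (forall j, (j < d)%nat -> 0 < w j -> h j < g -> h j <= hb) /\
    ((e = 1 /\ b <> a /\ 0 < w b /\ wb = w b /\ h b = hb) \/ (e = 0 /\ hb = 0 /\ wb = v))).
{ destruct (first_argmin d (fun j => 0 < w j /\ h j < g) (fun j => - h j))
    as [[b [Hb [[Wb Gb] Hmax]]]|Hn].
  - exists b, 1, (w b), (h b). repeat split; auto; try lra.
    + intros j Hj Wj Gj. destruct (Hmax j Hj); [tauto|lra|lra].
    + left. repeat split; auto. intros ->. lra.
  - exists j0, 0, v, 0. repeat split; auto; try lra.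
    intros j Hj Wj Gj. exfalso. apply (Hn j); auto. }
destruct Hb as [b [e [wb [hb [Hb [Wb [Hbg [Hmax Hor]]]]]]]].
(* The weight that makes [g] the mean [r * h a + (1 - r) * hb]. *)
set (r := (g - hb) / (h a - hb)).
assert (Er : r * (h a - hb) = g - hb) by (unfold r; field; lra).
assert (Hr : 0 < r <= 1) by (split; nra).
destruct (max_scale v (w a) wb r) as [t [Ht [Hta [Htb Hend]]]]; auto; try lra.
set (kap := fun j => (if Nat.eqb j a then t * r else 0) +
                     (if Nat.eqb j b then e * (t * (1 - r)) else 0)).
assert (Hk : forall x, sumd d (fun j => kap j * x j) = t * r * x a + e * (t * (1 - r)) * x b).
{ intro x. rewrite <- (sumd_delta d a (fun j => t * r * x j)) by auto.
  rewrite <- (sumd_delta d b (fun j => e * (t * (1 - r)) * x j)) by auto.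
  rewrite <- sumd_plus. apply sumd_ext; intros j _. unfold kap.
  destruct (Nat.eqb j a), (Nat.eqb j b); ring. }
assert (He : 0 <= e <= 1) by (destruct Hor as [[-> _]|[-> _]]; lra).
assert (Htr : 0 <= t * (1 - r)) by nra.
exists t, kap, hb, (h a).
split; [lra|]. split; [lra|]. split; [lra|].
split.
{ intros j Hj Wj. destruct (Rlt_dec (h j) g); [left; auto|right; apply Hmin'; auto; lra]. }
split.
{ intros j Hj. unfold kap. specialize (Hw j Hj).
  destruct (Nat.eqb_spec j a) as [Ea|Ea]; destruct (Nat.eqb_spec j b) as [Eb|Eb];
    destruct Hor as [[-> [? [? [? ?]]]]|[-> ?]]; try congruence;
    try subst j; split; nra. }
split.
{ rewrite (sumd_ext d kap (fun j => kap j * 1)) by (intros; ring).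
  rewrite (Hk (fun _ => 1)). nra. }
split.
{ intros s Hs. rewrite (Hk (fun j => ppart (h j - s))).
  assert (Hpb : e * ppart (h b - s) = ppart (hb - s)).
  { destruct Hor as [[-> [? [? [? ->]]]]|[-> [-> ?]]]; [ring|].
    rewrite (ppart_of_le (0 - s)) by lra. ring. }
  transitivity (t * (r * ppart (h a - s) + (1 - r) * ppart (hb - s))); [rewrite <- Hpb; ring|].
  f_equal. destruct Hs as [Hs|Hs].
  - rewrite !ppart_of_ge by lra. lra.
  - rewrite !ppart_of_le by lra. ring. }
destruct Hend as [->|[E|[Hr1 E]]]; [auto| |].
- right. exists a. repeat split; auto. unfold kap. rewrite Nat.eqb_refl.
  destruct (Nat.eqb_spec a b) as [->|_]; [|lra].
  destruct Hor as [[_ [H _]]|[-> _]]; [congruence|lra].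
- destruct Hor as [[-> [Hba [Wb' [-> _]]]]|[_ [_ ->]]]; [|nra].
  right. exists b. repeat split; auto. unfold kap. rewrite Nat.eqb_refl.
  destruct (Nat.eqb_spec b a) as [->|_]; [congruence|lra].
Qed.

(** Applied to the remaining target and source widths, this is the induction measure of
    [transport_plan]. *)
Fixpoint npos (d : nat) (f : nat -> R) : nat :=
  match d with
  | O => O
  | S d' => (npos d' f + if Rlt_dec 0 (f d') then 1 else 0)%nat
  end.

Lemma npos_le d f f' : (forall i, (i < d)%nat -> f' i <= f i) -> (npos d f' <= npos d f)%nat.
Proof.
induction d as [|d IH]; intro H; simpl; [lia|].
assert (f' d <= f d) by auto.
assert (npos d f' <= npos d f)%nat by auto.
destruct (Rlt_dec 0 (f' d)), (Rlt_dec 0 (f d)); (lia || lra).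
Qed.

Lemma npos_lt d f f' a : (forall i, (i < d)%nat -> f' i <= f i) ->
  (a < d)%nat -> 0 < f a -> f' a <= 0 -> (npos d f' < npos d f)%nat.
Proof.
induction d as [|d IH]; intros H Ha Hf Hf'; simpl; [lia|].
assert (f' d <= f d) by auto.
assert (npos d f' <= npos d f)%nat by (apply npos_le; auto).
destruct (Nat.eq_dec a d) as [->|].
- destruct (Rlt_dec 0 (f' d)), (Rlt_dec 0 (f d)); (lia || lra).
- assert (npos d f' < npos d f)%nat by (apply IH; auto; lia).
  destruct (Rlt_dec 0 (f' d)), (Rlt_dec 0 (f d)); (lia || lra).
Qed.

(** Weak submajorisation of the heights [g] with weights [v] by the heights [h] with weights [w],
    tested on hinge functions. *)
Definition dominated d (v g w h : nat -> R) : Prop :=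
  forall s, 0 <= s ->
    sumd d (fun i => v i * ppart (g i - s)) <= sumd d (fun j => w j * ppart (h j - s)).

(** Otherwise take for [s] the largest remaining source height (0 if no source remains): it lies
    below [g i0], so the right-hand side of domination vanishes while the left-hand side is
    positive. *)
Lemma dominated_source d v g w h i0 :
  (forall i, (i < d)%nat -> 0 <= v i) -> (forall j, (j < d)%nat -> 0 <= w j) ->
  (forall j, (j < d)%nat -> 0 <= h j) ->
  dominated d v g w h -> (i0 < d)%nat -> 0 < v i0 -> 0 < g i0 ->
  exists j, (j < d)%nat /\ 0 < w j /\ g i0 <= h j.
Proof.
intros Hv Hw Hh Hdom Hi0 V0 G0. apply NNPP; intro Hno.
assert (Hs : exists s, 0 <= s < g i0 /\ forall j, (j < d)%nat -> 0 < w j -> h j <= s).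
{ destruct (first_argmin d (fun j => 0 < w j) (fun j => - h j)) as [[m [Hm [Wm Hmax]]]|Hn].
  - exists (h m). split; [split; auto|].
    + apply Rnot_le_lt; intro. apply Hno. exists m; auto.
    + intros j Hj Wj. destruct (Hmax j Hj Wj); lra.
  - exists 0. split; [lra|]. intros j Hj Wj. exfalso; apply (Hn j); auto. }
destruct Hs as [s [Hs Hle]].
specialize (Hdom s (proj1 Hs)).
rewrite (sumd_eq0 d (fun j => w j * ppart (h j - s))) in Hdom.
- assert (H := sumd_ge_term d (fun i => v i * ppart (g i - s)) i0).
  simpl in H. rewrite (ppart_of_ge (g i0 - s)) in H by lra.
  assert (v i0 * (g i0 - s) <= sumd d (fun i => v i * ppart (g i - s))).
  { apply H; auto. intros i Hi. apply Rmult_le_pos; auto. apply ppart_ge0. }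
  nra.
- intros j Hj. destruct (Hw j Hj) as [Wj|<-]; [|ring].
  rewrite ppart_of_le; [ring|]. assert (h j <= s) by auto. lra.
Qed.

(* On the gap [hb, ha], free of remaining sources, the right-hand side is affine
   and the left-hand side convex, so only the complement has to be checked. *)
Lemma dominated_gap d v g w h hb ha :
  (forall i, (i < d)%nat -> 0 <= v i) ->
  0 <= hb < ha -> (forall j, (j < d)%nat -> w j = 0 \/ h j <= hb \/ ha <= h j) ->
  (forall s, 0 <= s <= hb \/ ha <= s ->
    sumd d (fun i => v i * ppart (g i - s)) <= sumd d (fun j => w j * ppart (h j - s))) ->
  dominated d v g w h.
Proof.
intros Hv Hba Hgap Hout s Hs.
destruct (Rle_dec s hb) as [H1|H1]; [apply Hout; lra|].
destruct (Rle_dec ha s) as [H2|H2]; [apply Hout; lra|].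
set (r := (ha - s) / (ha - hb)).
assert (Er : r * (ha - hb) = ha - s) by (unfold r; field; lra).
assert (Hr : 0 <= r <= 1) by (split; nra).
assert (Es : s = r * hb + (1 - r) * ha) by lra.
apply Rle_trans with (r * sumd d (fun i => v i * ppart (g i - hb)) +
                      (1 - r) * sumd d (fun i => v i * ppart (g i - ha))).
{ rewrite <- !sumd_scal, <- sumd_plus. apply sumd_le; intros i Hi.
  specialize (Hv i Hi). assert (P := ppart_convex r (g i - hb) (g i - ha) Hr).
  replace (r * (g i - hb) + (1 - r) * (g i - ha)) with (g i - s) in P by lra. nra. }
apply Rle_trans with (r * sumd d (fun j => w j * ppart (h j - hb)) +
                      (1 - r) * sumd d (fun j => w j * ppart (h j - ha))).
{ apply Rplus_le_compat; apply Rmult_le_compat_l; try lra; apply Hout; lra. }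
apply Req_le. rewrite <- !sumd_scal, <- sumd_plus. apply sumd_ext; intros j Hj.
destruct (Hgap j Hj) as [->|[H|H]]; [ring| |].
- rewrite !ppart_of_le by lra. ring.
- rewrite !ppart_of_ge by lra. rewrite Es. ring.
Qed.

(** [K i j] is the width of source [j] given to target [i]; rows may fall short of [v i] because the
    reservoir of height 0 supplies the rest. Each round serves one target by [two_point_window] and
    exhausts that target or some source. Outside the window both sides of domination drop by the
    same [t * ppart (g i0 - s)], and [dominated_gap] covers the window itself. *)
Lemma transport_plan d v g w h :
  (forall i, (i < d)%nat -> 0 <= v i) -> (forall i, (i < d)%nat -> 0 <= g i) ->
  (forall j, (j < d)%nat -> 0 <= w j) -> (forall j, (j < d)%nat -> 0 <= h j) ->
  dominated d v g w h ->
  exists K : nat -> nat -> R,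
    (forall i j, (i < d)%nat -> (j < d)%nat -> 0 <= K i j) /\
    (forall j, (j < d)%nat -> sumd d (fun i => K i j) <= w j) /\
    (forall i, (i < d)%nat -> sumd d (fun j => K i j) <= v i) /\
    (forall i, (i < d)%nat -> sumd d (fun j => K i j * h j) = v i * g i).
Proof.
intros Hv Hg Hw Hh.
remember (npos d v + npos d w)%nat as N eqn:EN.
revert v w Hv Hw EN.
induction N as [N IH] using lt_wf_ind; intros v w Hv Hw EN Hdom.
destruct (classic (exists i, (i < d)%nat /\ 0 < v i /\ 0 < g i)) as [[i0 [Hi0 [V0 G0]]]|Hno].
2: { exists (fun _ _ => 0).
  split; [intros; lra|]. split; [intros; rewrite sumd_0; auto|].
  split; [intros; rewrite sumd_0; auto|].
  intros i Hi. rewrite sumd_eq0 by (intros; ring).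
  destruct (Hv i Hi) as [V|<-]; [|ring]. destruct (Hg i Hi) as [G|<-]; [|ring].
  exfalso; apply Hno; exists i; auto. }
destruct (two_point_window d w h (v i0) (g i0)) as
  [t [kap [hb [ha [Hhb [Hgg [Ht [Hgap [Hkap [Hsum [Hpos Hend]]]]]]]]]]]; auto.
{ apply (dominated_source d v g w h i0); auto. }
set (del := fun i => if Nat.eqb i i0 then t else 0).
assert (Hdel : forall i, (i < d)%nat -> 0 <= del i <= v i).
{ intros i Hi. unfold del. destruct (Nat.eqb_spec i i0) as [->|]; [auto|].
  split; [lra|auto]. }
set (v' := fun i => v i - del i). set (w' := fun j => w j - kap j).
assert (Hlv : forall i, (i < d)%nat -> 0 <= v' i <= v i)
  by (intros i Hi; specialize (Hdel i Hi); unfold v'; lra).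
assert (Hlw : forall i, (i < d)%nat -> 0 <= w' i <= w i)
  by (intros i Hi; specialize (Hkap i Hi); unfold w'; lra).
assert (HN : (npos d v' + npos d w' < N)%nat).
{ assert (npos d v' <= npos d v)%nat by (apply npos_le; intros; apply Hlv; auto).
  assert (npos d w' <= npos d w)%nat by (apply npos_le; intros; apply Hlw; auto).
  destruct Hend as [E|[j [Hj [Wj Kj]]]].
  - assert (npos d v' < npos d v)%nat; [|lia].
    apply (npos_lt d v v' i0); auto; [intros; apply Hlv; auto|].
    unfold v', del. rewrite Nat.eqb_refl. lra.
  - assert (npos d w' < npos d w)%nat; [|lia].
    apply (npos_lt d w w' j); auto; [intros; apply Hlw; auto|].
    unfold w'. lra. }
destruct (IH _ HN v' w') as [K [K0 [Kw [Kv Kh]]]]; auto;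
  try (intros; now apply Hlv); try (intros; now apply Hlw).
{ apply (dominated_gap d v' g w' h hb ha); [intros; now apply Hlv|lra| |].
  - intros j Hj. destruct (Hlw j Hj) as [W1 W2]. destruct W1 as [W1|W1]; [right|left; auto].
    apply Hgap; auto; lra.
  - intros s Hs.
    assert (Hs0 : 0 <= s) by lra.
    assert (E1 : sumd d (fun i => v' i * ppart (g i - s)) =
                 sumd d (fun i => v i * ppart (g i - s)) - t * ppart (g i0 - s)).
    { rewrite <- (sumd_delta d i0 (fun i => t * ppart (g i - s))) by auto.
      rewrite <- sumd_minus. apply sumd_ext; intros i _. unfold v', del.
      destruct (Nat.eqb i i0); ring. }
    assert (E2 : sumd d (fun j => w' j * ppart (h j - s)) =
                 sumd d (fun j => w j * ppart (h j - s)) - t * ppart (g i0 - s)).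
    { rewrite <- Hpos by auto.
      rewrite <- sumd_minus. apply sumd_ext; intros i _. unfold w'. ring. }
    rewrite E1, E2. specialize (Hdom s Hs0). lra. }
exists (fun i j => K i j + if Nat.eqb i i0 then kap j else 0).
split; [|split; [|split]].
- intros i j Hi Hj. specialize (K0 i j Hi Hj). specialize (Hkap j Hj).
  destruct (Nat.eqb i i0); lra.
- intros j Hj. rewrite sumd_plus, (sumd_delta d i0 (fun _ => kap j)) by auto.
  specialize (Kw j Hj). unfold w' in Kw. lra.
- intros i Hi. rewrite sumd_plus. specialize (Kv i Hi). unfold v', del in Kv.
  destruct (Nat.eqb i i0) in Kv |- *; [change (sumd d (fun j => K i j) + sumd d kap <= v i)
    |rewrite sumd_0; change (sumd d (fun j => K i j) + 0 <= v i)]; lra.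
- intros i Hi. specialize (Kh i Hi). unfold v', del in Kh.
  rewrite (sumd_ext d _ (fun j => K i j * h j + (if Nat.eqb i i0 then kap j * h j else 0)))
    by (intros; destruct (Nat.eqb i i0); ring).
  rewrite sumd_plus, Kh. clear Kh. destruct (Nat.eqb_spec i i0) as [->|]; [|rewrite sumd_0; ring].
  (* At [s = 0] the hinge identity is the mass balance of this round: the sum of [kap j * h j] is
     [t * g i0]. *)
  assert (P := Hpos 0 ltac:(lra)). rewrite (ppart_of_ge (g i0 - 0)) in P by lra.
  rewrite (sumd_ext d _ (fun j => kap j * h j)) in P.
  + rewrite P. ring.
  + intros j Hj. rewrite ppart_of_ge; [ring|]. specialize (Hh j Hj). lra.
Qed.

(** * Completing a plan to a Gibbs-stochastic matrix *)

Lemma gibbs_stochastic_of_plan d u v h q (K : nat -> nat -> R) :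
  (forall i, (i < d)%nat -> 0 <= u i) -> (forall i, (i < d)%nat -> 0 <= v i) ->
  (forall i, (i < d)%nat -> u i = 0 \/ v i = 0) -> 0 < sumd d v ->
  (forall i j, (i < d)%nat -> (j < d)%nat -> 0 <= K i j) ->
  (forall j, (j < d)%nat -> sumd d (fun i => K i j) <= u j) ->
  (forall i, (i < d)%nat -> sumd d (fun j => K i j) <= v i) ->
  (forall i, (i < d)%nat -> sumd d (fun j => K i j * h j) = q i) ->
  exists B : nat -> nat -> R,
    (forall i j, (i < d)%nat -> (j < d)%nat -> 0 <= B i j) /\
    (forall j, (j < d)%nat -> sumd d (fun i => B i j) = 1) /\
    (forall i, (i < d)%nat -> sumd d (fun j => B i j * (u j + v j)) = u i + v i) /\
    (forall i, (i < d)%nat -> 0 < v i -> sumd d (fun j => B i j * (u j * h j)) = q i).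
Proof.
intros Hu Hv Hdis HV K0 Ku Kv Kh.
set (out := fun j => sumd d (fun i => K i j)).
set (inn := fun i => sumd d (fun j => K i j)).
assert (Hout0 : forall j, (j < d)%nat -> 0 <= out j)
  by (intros; apply sumd_ge0; auto).
assert (HK : forall i j, (i < d)%nat -> (j < d)%nat -> K i j <= u j).
{ intros i j Hi Hj. apply Rle_trans with (out j); [|apply Ku; auto].
  apply (sumd_ge_term d (fun i => K i j)); auto. }
assert (Etot : sumd d out = sumd d inn) by apply sumd_exch.
set (c := fun i => (out i + (v i - inn i)) / sumd d v).
assert (Hc : forall i, (i < d)%nat -> 0 <= c i).
{ intros i Hi. apply Rdiv_le_0_compat; auto. specialize (Hout0 i Hi). specialize (Kv i Hi).
  fold (inn i) in Kv. lra. }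
assert (Ec : sumd d c = 1).
{ unfold c. rewrite (sumd_ext d _ (fun i => / sumd d v * (out i + (v i - inn i))))
    by (intros; unfold Rdiv; ring).
  rewrite sumd_scal, sumd_plus, sumd_minus, Etot. field; lra. }
set (Bw := fun i j => c i * v j + K i j + (if Nat.eqb j i then u j - out j else 0)).
(* A level of zero weight gets an identity column; [Bw] vanishes there too, so [HB] holds for every
   column. *)
set (B := fun i j => if Rlt_dec 0 (u j + v j) then Bw i j / (u j + v j)
                     else if Nat.eqb i j then 1 else 0).
assert (HB : forall i j, (i < d)%nat -> (j < d)%nat -> B i j * (u j + v j) = Bw i j).
{ intros i j Hi Hj. unfold B. destruct Rlt_dec as [Hw|Hw]; [field; lra|].
  assert (H1 := Hu j Hj). assert (H2 := Hv j Hj).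
  assert (H3 := Ku j Hj). fold (out j) in H3. assert (H4 := Hout0 j Hj).
  assert (H5 := HK i j Hi Hj). assert (H6 := K0 i j Hi Hj).
  assert (Ev : v j = 0) by lra. assert (Eu : u j = 0) by lra.
  unfold Bw. rewrite Ev, Eu. replace (out j) with 0 by lra. replace (K i j) with 0 by lra.
  destruct (Nat.eqb j i); ring. }
exists B. split; [|split; [|split]].
- intros i j Hi Hj. unfold B. destruct Rlt_dec as [Hw|Hw]; [|destruct Nat.eqb; lra].
  apply Rdiv_le_0_compat; auto. unfold Bw.
  assert (0 <= c i * v j) by (apply Rmult_le_pos; auto).
  assert (H3 := Ku j Hj). fold (out j) in H3. specialize (K0 i j Hi Hj).
  destruct (Nat.eqb j i); lra.
- intros j Hj. unfold B. destruct Rlt_dec as [Hw|Hw].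
  + rewrite (sumd_ext d _ (fun i => / (u j + v j) * (v j * c i + K i j +
      (if Nat.eqb i j then u j - out j else 0)))).
    * rewrite sumd_scal, !sumd_plus, sumd_scal, Ec, (sumd_delta d j (fun _ => u j - out j)) by auto.
      fold (out j). field; lra.
    * intros i Hi. unfold Bw. rewrite (Nat.eqb_sym j i). unfold Rdiv. ring.
  + apply (sumd_delta d j (fun _ => 1)); auto.
- intros i Hi. rewrite (sumd_ext d _ (fun j => Bw i j)) by auto.
  unfold Bw. rewrite !sumd_plus, sumd_scal.
  rewrite (sumd_delta d i (fun j => u j - out j)) by auto.
  change (c i * sumd d v + inn i + (u i - out i) = u i + v i).
  unfold c. field; lra.
- intros i Hi Vi. rewrite <- (Kh i Hi).
  assert (Ui : u i = 0) by (destruct (Hdis i Hi); lra).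
  apply sumd_ext; intros j Hj.
  destruct (Hdis j Hj) as [Uj|Vj].
  + assert (H5 := HK i j Hi Hj). assert (H6 := K0 i j Hi Hj).
    replace (K i j) with 0 by lra. rewrite Uj. ring.
  + transitivity (B i j * (u j + v j) * h j); [rewrite Vj; ring|].
    rewrite HB by auto. unfold Bw. rewrite Vj.
    destruct (Nat.eqb_spec j i) as [->|_]; [|ring].
    assert (H3 := Ku i Hi). fold (out i) in H3. assert (H4 := Hout0 i Hi).
    replace (u i - out i) with 0 by lra. ring.
Qed.

(** * Lorenz curves *)

(** For [w >= 0], the length of the part of the block [[a, a + w]] to the left of [l]. *)
Definition overlap (a w l : R) : R := Rmax 0 (Rmin w (l - a)).

Lemma overlap_bounds a w l : 0 <= w -> 0 <= overlap a w l <= w.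
Proof. unfold overlap, Rmax, Rmin; intros; repeat destruct Rle_dec; lra. Qed.

Lemma overlap_le a w l : 0 <= a -> 0 <= l -> overlap a w l <= l.
Proof. unfold overlap, Rmax, Rmin; intros; repeat destruct Rle_dec; lra. Qed.

Lemma overlap_lipschitz a w x y : x <= y -> overlap a w y - overlap a w x <= y - x.
Proof. unfold overlap, Rmax, Rmin; intros; repeat destruct Rle_dec; lra. Qed.

Lemma overlap_full a w l : 0 <= w -> a + w <= l -> overlap a w l = w.
Proof. unfold overlap, Rmax, Rmin; intros; repeat destruct Rle_dec; lra. Qed.

Lemma is_RInt_piece (f : R -> R) a b c :
  a <= b -> (forall x, a < x < b -> f x = c) -> is_RInt f a b (c * (b - a)).
Proof.
intros Hab H. apply (is_RInt_ext (fun _ => c)).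
- intros x Hx. rewrite Rmin_left, Rmax_right in Hx by lra. symmetry; auto.
- replace (c * (b - a)) with (scal (b - a) c) by (unfold scal; simpl; unfold mult; simpl; ring).
  apply (is_RInt_const (V := R_NormedModule)).
Qed.

Lemma is_RInt_block a w c l : 0 <= a -> 0 <= w -> 0 <= l ->
  is_RInt (fun x => if Rle_dec a x then if Rlt_dec x (a + w) then c else 0 else 0)
    0 l (c * overlap a w l).
Proof.
intros Ha Hw Hl. set (f := fun x => _).
assert (F0 : forall x, x < a -> f x = 0)
  by (intros; unfold f; repeat destruct Rle_dec; lra).
assert (F1 : forall x, a < x < a + w -> f x = c)
  by (intros; unfold f; destruct Rle_dec; [destruct Rlt_dec|]; lra).
assert (F2 : forall x, a + w < x -> f x = 0)
  by (intros; unfold f; destruct Rle_dec; [destruct Rlt_dec|]; lra).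
destruct (Rle_dec l a) as [H|H].
{ replace (overlap a w l) with 0
    by (unfold overlap, Rmax, Rmin; repeat destruct Rle_dec; lra).
  replace (c * 0) with (0 * (l - 0)) by ring.
  apply is_RInt_piece; auto. intros; apply F0; lra. }
assert (I0 : is_RInt f 0 a 0).
{ replace 0 with (0 * (a - 0)) at 2 by ring. apply is_RInt_piece; auto.
  intros; apply F0; lra. }
destruct (Rle_dec l (a + w)) as [H'|H'].
- replace (overlap a w l) with (l - a)
    by (unfold overlap, Rmax, Rmin; repeat destruct Rle_dec; lra).
  replace (c * (l - a)) with (plus 0 (c * (l - a))).
  + apply (is_RInt_Chasles (V := R_NormedModule)) with a; auto. apply is_RInt_piece; [lra|].
    intros; apply F1; lra.
  + unfold plus; simpl. ring.
- replace (c * overlap a w l) with (plus 0 (plus (c * (a + w - a)) (0 * (l - (a + w))))).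
  + apply (is_RInt_Chasles (V := R_NormedModule)) with a; auto.
    apply (is_RInt_Chasles (V := R_NormedModule)) with (a + w); apply is_RInt_piece; auto; try lra.
    intros; apply F2; lra.
  + unfold plus; simpl. rewrite overlap_full by lra. ring.
Qed.

Lemma is_RInt_sumd d (f : nat -> R -> R) (I : nat -> R) a b :
  (forall i, (i < d)%nat -> is_RInt (f i) a b (I i)) ->
  is_RInt (fun x => sumd d (fun i => f i x)) a b (sumd d I).
Proof.
induction d as [|d IH]; intro H.
- change (sumd 0 I) with 0. replace 0 with (scal (b - a) 0)
    by (unfold scal; simpl; unfold mult; simpl; ring).
  apply (is_RInt_const (V := R_NormedModule)).
- rewrite sumd_S. apply (is_RInt_ext (fun x => plus (sumd d (fun i => f i x)) (f d x))).
  + intros x _. now rewrite sumd_S.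
  + apply (is_RInt_plus (V := R_NormedModule)); auto.
Qed.

(** Closed form of the integral of [GibbsResc] over [[0, l]]; see [is_RInt_GibbsResc]. *)
Definition lorenz (k T : R) (d : nat) (s : State) (l : R) : R :=
  sumd d (fun i => blk_h k T s i * overlap (blk_start k T d s i) (blk_w k T s i) l).

Lemma blk_w_ge0 k T s i : 0 <= blk_w k T s i.
Proof.
unfold blk_w, boltz. destruct (En s i); [left; apply exp_pos|lra].
Qed.

Lemma blk_h_ge0 k T d s i : IsState d s -> (i < d)%nat -> 0 <= blk_h k T s i.
Proof.
intros [H _] Hi. unfold blk_h. destruct (En s i); [|lra].
apply Rmult_le_pos; auto. left; apply exp_pos.
Qed.

Lemma blk_area k T d s i : IsState d s -> (i < d)%nat ->
  blk_w k T s i * blk_h k T s i = lam s i.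
Proof.
intros [_ [_ [H _]]] Hi. unfold blk_w, blk_h, boltz. specialize (H i Hi).
destruct (En s i) as [x|]; [|rewrite H by auto; ring].
transitivity (lam s i * (exp (- x / (k * T)) * exp (x / (k * T)))); [ring|].
rewrite <- exp_plus. replace (- x / (k * T) + x / (k * T)) with 0 by (unfold Rdiv; ring).
rewrite exp_0. ring.
Qed.

(** The nested tests of [blk_start] as one boolean relation, a strict linear order on the levels. *)
Definition before (k T : R) (s : State) (j i : nat) : bool :=
  if Rgt_dec (blk_h k T s j) (blk_h k T s i) then true
  else if Req_EM_T (blk_h k T s j) (blk_h k T s i) then Nat.ltb j i else false.

Lemma before_iff k T s j i : before k T s j i = true <->
  blk_h k T s i < blk_h k T s j \/ (blk_h k T s j = blk_h k T s i /\ (j < i)%nat).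
Proof.
unfold before. destruct Rgt_dec as [H|H]; [tauto|].
destruct Req_EM_T as [E|E].
- rewrite Nat.ltb_lt. split; [auto|]. intros [?|[_ ?]]; [lra|auto].
- split; [discriminate|]. intros [?|[? _]]; lra.
Qed.

Lemma blk_start_before k T d s i : blk_start k T d s i =
  sumd d (fun j => if before k T s j i then blk_w k T s j else 0).
Proof.
apply sumd_ext; intros j _. unfold before.
destruct Rgt_dec; [auto|]. destruct Req_EM_T; auto.
Qed.

Lemma blk_start_ge0 k T d s i : 0 <= blk_start k T d s i.
Proof.
rewrite blk_start_before. apply sumd_ge0; intros j _.
destruct before; [apply blk_w_ge0|lra].
Qed.

(** The end of a block is the total width of the level and its predecessors, all of which lie in
    [P]. Used for the predecessors of another block, for the levels above a threshold, and for all
    levels. *)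
Lemma blk_end_le k T d s i (P : nat -> bool) :
  (i < d)%nat -> P i = true -> (forall j, before k T s j i = true -> P j = true) ->
  blk_start k T d s i + blk_w k T s i <= sumd d (fun j => if P j then blk_w k T s j else 0).
Proof.
intros Hi Pi HP. rewrite blk_start_before.
rewrite <- (sumd_delta d i (fun j => blk_w k T s j)) by auto. rewrite <- sumd_plus.
apply sumd_le; intros j _. assert (W := blk_w_ge0 k T s j). specialize (HP j).
destruct (Nat.eqb_spec j i) as [->|_].
- rewrite Pi. destruct (before k T s i i) eqn:E; [|lra].
  apply before_iff in E. destruct E as [E|[_ E]]; [lra|lia].
- destruct (before k T s j i); [rewrite HP by auto; lra|].
  destruct (P j); lra.
Qed.

Lemma blk_disjoint k T d s i j :
  (i < d)%nat -> (j < d)%nat -> i <> j ->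
  blk_start k T d s i + blk_w k T s i <= blk_start k T d s j \/
  blk_start k T d s j + blk_w k T s j <= blk_start k T d s i.
Proof.
assert (H : forall a b, (a < d)%nat -> before k T s a b = true ->
  blk_start k T d s a + blk_w k T s a <= blk_start k T d s b).
{ intros a b Ha Hab. rewrite (blk_start_before k T d s b). apply blk_end_le; auto.
  intros c Hc. rewrite before_iff in *. intuition (lra || lia). }
intros Hi Hj Hne.
destruct (Rtotal_order (blk_h k T s i) (blk_h k T s j)) as [E|[E|E]].
- right. apply H, before_iff; auto.
- destruct (Nat.lt_total i j) as [L|[L|L]]; [left|lia|right]; apply H; auto;
    apply before_iff; right; auto.
- left. apply H, before_iff; auto.
Qed.

Lemma sumd_indicator_le1 d f :
  (forall i, (i < d)%nat -> f i = 0 \/ f i = 1) ->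
  (forall i j, (i < d)%nat -> (j < d)%nat -> i <> j -> f i = 0 \/ f j = 0) ->
  sumd d f <= 1.
Proof.
induction d as [|d IH]; intros H01 Hd; [unfold sumd; simpl; lra|]. rewrite sumd_S.
destruct (H01 d) as [E|E]; auto; rewrite E.
- rewrite Rplus_0_r. apply IH; auto.
- rewrite sumd_eq0; [lra|]. intros i Hi.
  destruct (Hd i d) as [|E']; auto; [lia|lra].
Qed.

(** The half-open blocks are disjoint, so their indicators sum to at most 1; integrate this over
    [[0, l]]. *)
Lemma sumd_overlap_le k T d s l : 0 <= l ->
  sumd d (fun i => overlap (blk_start k T d s i) (blk_w k T s i) l) <= l.
Proof.
intro Hl.
set (f := fun i x => if Rle_dec (blk_start k T d s i) x then
  if Rlt_dec x (blk_start k T d s i + blk_w k T s i) then 1 else 0 else 0).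
assert (I1 : is_RInt (fun x => sumd d (fun i => f i x)) 0 l
  (sumd d (fun i => overlap (blk_start k T d s i) (blk_w k T s i) l))).
{ apply is_RInt_sumd; intros i Hi. rewrite <- (Rmult_1_l (overlap _ _ _)).
  apply is_RInt_block; auto; [apply blk_start_ge0|apply blk_w_ge0]. }
assert (I2 : is_RInt (fun _ => 1) 0 l (1 * (l - 0))) by (apply is_RInt_piece; auto).
apply Rle_trans with (1 * (l - 0)); [|lra].
apply (is_RInt_le _ _ _ _ _ _ Hl I1 I2).
intros x _. apply sumd_indicator_le1.
- intros i _. unfold f. destruct Rle_dec; [destruct Rlt_dec|]; auto.
- intros i j Hi Hj Hne. unfold f.
  destruct (blk_disjoint k T d s i j Hi Hj Hne);
    repeat (destruct Rle_dec || destruct Rlt_dec); auto; lra.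
Qed.

(** * The mixing condition in terms of Lorenz curves *)

Lemma is_RInt_GibbsResc k T d s l : 0 <= l ->
  is_RInt (GibbsResc k T d s) 0 l (lorenz k T d s l).
Proof.
intro Hl. apply (is_RInt_sumd d (fun i x => if Rle_dec (blk_start k T d s i) x then
  if Rlt_dec x (blk_start k T d s i + blk_w k T s i) then blk_h k T s i else 0 else 0)).
intros i _. apply is_RInt_block; auto; [apply blk_start_ge0|apply blk_w_ge0].
Qed.

Lemma MixCond_lorenz k T d rho sigma c m : 0 < c -> 0 <= m ->
  MixCond (fun x => GibbsResc k T d rho x / c) (GibbsResc k T d sigma) m <->
  (forall l, 0 <= l -> c * lorenz k T d sigma (l * m) <= lorenz k T d rho l).
Proof.
intros Hc Hm.
assert (If : forall l, 0 <= l ->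
  is_RInt (fun x => GibbsResc k T d rho x / c) 0 l (lorenz k T d rho l / c)).
{ intros l Hl. apply (is_RInt_ext (fun x => scal (/ c) (GibbsResc k T d rho x))).
  - intros x _. unfold scal; simpl; unfold mult; simpl. unfold Rdiv; ring.
  - replace (lorenz k T d rho l / c) with (scal (/ c) (lorenz k T d rho l))
      by (unfold scal; simpl; unfold mult; simpl; unfold Rdiv; ring).
    apply (is_RInt_scal (V := R_NormedModule)), is_RInt_GibbsResc; auto. }
assert (Ig : forall l, 0 <= l ->
  is_RInt (GibbsResc k T d sigma) 0 (l * m) (lorenz k T d sigma (l * m)))
  by (intros l Hl; apply is_RInt_GibbsResc, Rmult_le_pos; auto).
assert (Hdiv : forall x y, c * y <= x <-> x / c >= y).
{ intros x y. split; intro H.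
  - apply Rle_ge, Rmult_le_reg_l with c; auto. replace (c * (x / c)) with x by (field; lra). auto.
  - replace x with (c * (x / c)) by (field; lra). apply Rmult_le_compat_l; lra. }
split; intros H l Hl; specialize (H l Hl).
- destruct H as [pf [pg H]]. rewrite <- !RInt_Reals in H.
  rewrite (is_RInt_unique _ _ _ _ (If l Hl)), (is_RInt_unique _ _ _ _ (Ig l Hl)) in H.
  now apply Hdiv.
- exists (ex_RInt_Reals_0 _ _ _ (ex_intro _ _ (If l Hl))).
  exists (ex_RInt_Reals_0 _ _ _ (ex_intro _ _ (Ig l Hl))).
  rewrite <- !RInt_Reals.
  rewrite (is_RInt_unique _ _ _ _ (If l Hl)), (is_RInt_unique _ _ _ _ (Ig l Hl)).
  now apply Hdiv.
Qed.

(* The next two lemmas express that the Lorenz curve is the concave conjugate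
   of [t |-> sum_i w_i (h_i - t)_+]. *)
Lemma lorenz_le k T d s l t : 0 <= l -> 0 <= t ->
  lorenz k T d s l <= t * l + sumd d (fun i => blk_w k T s i * ppart (blk_h k T s i - t)).
Proof.
intros Hl Ht.
apply Rle_trans with (t * sumd d (fun i => overlap (blk_start k T d s i) (blk_w k T s i) l) +
  sumd d (fun i => blk_w k T s i * ppart (blk_h k T s i - t))).
- rewrite <- sumd_scal, <- sumd_plus. apply sumd_le; intros i _.
  assert (W := overlap_bounds (blk_start k T d s i) (blk_w k T s i) l (blk_w_ge0 k T s i)).
  assert (P0 := ppart_ge0 (blk_h k T s i - t)). assert (P := ppart_ge (blk_h k T s i - t)).
  nra.
- assert (H := sumd_overlap_le k T d s l Hl). nra.
Qed.

Lemma lorenz_touches k T d s t : IsState d s -> 0 <= t ->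
  exists l, 0 <= l /\
  sumd d (fun i => blk_w k T s i * ppart (blk_h k T s i - t)) <= lorenz k T d s l - t * l.
Proof.
intros Hs Ht.
(* The point of contact is the total width of the blocks higher than [t], where the rescaling falls
   to [t] or below. *)
set (P := fun j => if Rlt_dec t (blk_h k T s j) then true else false).
exists (sumd d (fun j => if P j then blk_w k T s j else 0)).
split.
{ apply sumd_ge0; intros j _. destruct (P j); [apply blk_w_ge0|lra]. }
unfold lorenz. rewrite <- (sumd_scal d t), <- sumd_minus. apply sumd_le; intros i Hi.
assert (W := blk_w_ge0 k T s i). assert (Hh := blk_h_ge0 k T d s i Hs Hi).
destruct (P i) eqn:E.
- rewrite overlap_full; auto.
  + unfold P in E. destruct Rlt_dec; [|discriminate]. rewrite ppart_of_ge by lra. lra.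
  + apply blk_end_le; auto. intros j Hj. apply before_iff in Hj.
    unfold P in *. destruct (Rlt_dec t (blk_h k T s i)); [|discriminate].
    destruct Rlt_dec; [auto|lra].
- unfold P in E. destruct Rlt_dec; [discriminate|]. rewrite ppart_of_le by lra.
  assert (O := overlap_bounds (blk_start k T d s i) (blk_w k T s i)
    (sumd d (fun j => if P j then blk_w k T s j else 0)) W). nra.
Qed.

(** Homogeneity turns level [t] for the rescaled target into level [t / (c * m)] for sigma. Chain
    three facts: the contact point [l] of sigma at that level, the Lorenz inequality at [l / m], and
    the linear upper bound for rho with slope [t]. *)
Lemma dominated_of_lorenz k T d rho sigma c m :
  IsState d sigma -> 0 < c -> 0 < m ->
  (forall l, 0 <= l -> c * lorenz k T d sigma (l * m) <= lorenz k T d rho l) ->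
  dominated d (fun i => blk_w k T sigma i / m) (fun i => c * m * blk_h k T sigma i)
              (blk_w k T rho) (blk_h k T rho).
Proof.
intros Hs Hc Hm H t Ht.
assert (Hcm : 0 < c * m) by nra.
assert (Htc : 0 <= t / (c * m)) by (apply Rdiv_le_0_compat; auto).
destruct (lorenz_touches k T d sigma (t / (c * m)) Hs Htc) as [l [Hl Htouch]].
assert (Hlm : 0 <= l / m) by (apply Rdiv_le_0_compat; auto).
specialize (H (l / m) Hlm). replace (l / m * m) with l in H by (field; lra).
assert (Hle := lorenz_le k T d rho (l / m) t Hlm Ht).
rewrite (sumd_ext d _ (fun i => c * (blk_w k T sigma i * ppart (blk_h k T sigma i - t / (c * m))))).
- rewrite sumd_scal. apply Rmult_le_compat_l with (r := c) in Htouch; [|lra].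
  replace (c * (lorenz k T d sigma l - t / (c * m) * l))
    with (c * lorenz k T d sigma l - t * (l / m)) in Htouch by (field; lra). lra.
- intros i _.
  replace (c * m * blk_h k T sigma i - t)
    with (c * m * (blk_h k T sigma i - t / (c * m))) by (field; lra).
  set (y := blk_h k T sigma i - t / (c * m)).
  destruct (Rle_dec 0 y).
  + rewrite !ppart_of_ge by nra. field; lra.
  + rewrite !ppart_of_le by nra. ring.
Qed.

(** * Relative mixedness *)

Lemma lorenz_lipschitz k T d s x y : IsState d s -> x <= y ->
  lorenz k T d s y - lorenz k T d s x <= sumd d (blk_h k T s) * (y - x).
Proof.
intros Hs Hxy. unfold lorenz. rewrite Rmult_comm, <- sumd_scal, <- sumd_minus.
apply sumd_le; intros i Hi. assert (Hh := blk_h_ge0 k T d s i Hs Hi).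
assert (L := overlap_lipschitz (blk_start k T d s i) (blk_w k T s i) x y Hxy). nra.
Qed.

Lemma lorenz_le_linear k T d s l : IsState d s -> 0 <= l ->
  lorenz k T d s l <= sumd d (blk_h k T s) * l.
Proof.
intros Hs Hl. unfold lorenz. rewrite Rmult_comm, <- sumd_scal.
apply sumd_le; intros i Hi. rewrite Rmult_comm.
apply Rmult_le_compat_r; [eapply blk_h_ge0; eauto|].
apply overlap_le; auto. apply blk_start_ge0.
Qed.

Lemma lorenz_le1 k T d s l : IsState d s -> lorenz k T d s l <= 1.
Proof.
intros Hs. replace 1 with (sumd d (lam s)) by apply Hs.
apply sumd_le; intros i Hi. rewrite <- (blk_area k T d s i) by auto.
rewrite Rmult_comm. apply Rmult_le_compat_r; [eapply blk_h_ge0; eauto|].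
apply overlap_bounds, blk_w_ge0.
Qed.

Lemma lorenz_full k T d s l : IsState d s -> sumd d (blk_w k T s) <= l ->
  lorenz k T d s l = 1.
Proof.
intros Hs Hl. replace 1 with (sumd d (lam s)) by apply Hs.
apply sumd_ext; intros i Hi. rewrite <- (blk_area k T d s i) by auto.
rewrite overlap_full; [ring|apply blk_w_ge0|].
eapply Rle_trans; [|exact Hl].
apply (blk_end_le k T d s i (fun _ => true)); auto.
Qed.

(** A positive block starting at 0 makes the Lorenz curve grow linearly there, which [relmix_exists]
    needs to find an admissible [m]. *)
Lemma top_block k T d s : IsState d s ->
  exists a, (a < d)%nat /\ blk_start k T d s a = 0 /\ 0 < blk_h k T s a /\ 0 < blk_w k T s a.
Proof.
intros Hs.
destruct (sumd_pos_term d (lam s)) as [i [Hi Li]]; [destruct Hs as [_ [-> _]]; lra|].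
assert (W := blk_w_ge0 k T s i). assert (H := blk_h_ge0 k T d s i Hs Hi).
assert (A := blk_area k T d s i Hs Hi).
destruct (first_argmin d (fun _ => True) (fun j => - blk_h k T s j)) as [[a [Ha [_ Hmax]]]|Hn];
  [|exfalso; apply (Hn i Hi); auto].
assert (H0 : 0 < blk_h k T s a) by (destruct (Hmax i Hi); auto; nra).
exists a. repeat split; auto.
- rewrite blk_start_before. apply sumd_eq0; intros j Hj.
  destruct (before k T s j a) eqn:E; auto. apply before_iff in E.
  destruct (Hmax j Hj); auto; [lra|]. destruct E; [lra|lia].
- unfold blk_h in H0. unfold blk_w, boltz. destruct (En s a); [apply exp_pos|lra].
Qed.

(** The admissible [m] form a nonempty set bounded above. Its supremum is admissible too, because
    the Lorenz curve of sigma is Lipschitz. *)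
Lemma relmix_exists k T d rho sigma c :
  IsState d rho -> IsState d sigma -> 0 < c <= 1 ->
  exists M, IsRelMix (fun x => GibbsResc k T d rho x / c) (GibbsResc k T d sigma) M.
Proof.
intros Hr Hs Hc.
set (P := fun m => 0 < m /\
  forall l, 0 <= l -> c * lorenz k T d sigma (l * m) <= lorenz k T d rho l).
set (Zr := sumd d (blk_w k T rho)). set (Zs := sumd d (blk_w k T sigma)).
set (Hgr := sumd d (blk_h k T rho)). set (Hgs := sumd d (blk_h k T sigma)).
destruct (top_block k T d rho Hr) as [a [Ha [A0 [Ah Aw]]]].
destruct (top_block k T d sigma Hs) as [b [Hb [_ [Bh _]]]].
assert (Hgr0 : 0 < Hgr).
{ eapply Rlt_le_trans; [exact Ah|]. apply (sumd_ge_term d (blk_h k T rho)); auto.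
  intros; eapply blk_h_ge0; eauto. }
assert (Hgs0 : 0 < Hgs).
{ eapply Rlt_le_trans; [exact Bh|]. apply (sumd_ge_term d (blk_h k T sigma)); auto.
  intros; eapply blk_h_ge0; eauto. }
assert (Zr0 : blk_w k T rho a <= Zr).
{ apply (sumd_ge_term d (blk_w k T rho)); auto. intros; apply blk_w_ge0. }
assert (Hne : exists m, P m).
(* For [l <= Zr] the top block alone gives rho at least [blk_h a * l * blk_w a / Zr], and sigma has
   at most [Hgs * l * m]; this [m] equates the two. Beyond [Zr] the curve of rho is already 1. *)
{ exists (blk_h k T rho a * blk_w k T rho a / (Zr * Hgs)).
  assert (Pm : 0 < blk_h k T rho a * blk_w k T rho a / (Zr * Hgs)).
  { apply Rdiv_lt_0_compat; apply Rmult_lt_0_compat; lra. }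
  split; [auto|]. intros l Hl.
  set (m := blk_h k T rho a * blk_w k T rho a / (Zr * Hgs)) in *.
  assert (Hlm : 0 <= l * m) by nra.
  destruct (Rle_dec Zr l) as [HZ|HZ].
  { rewrite (lorenz_full k T d rho l) by auto.
    assert (L := lorenz_le1 k T d sigma (l * m) Hs). nra. }
  assert (L := lorenz_le_linear k T d sigma (l * m) Hs Hlm). fold Hgs in L.
  assert (X : 0 <= Hgs * (l * m)) by (apply Rmult_le_pos; lra).
  apply Rle_trans with (Hgs * (l * m)); [clear -L X Hc; nra|].
  apply Rle_trans with (blk_h k T rho a * overlap (blk_start k T d rho a) (blk_w k T rho a) l).
  - replace (Hgs * (l * m)) with (blk_h k T rho a * (l * (blk_w k T rho a / Zr)))
      by (unfold m; field; lra).
    apply Rmult_le_compat_l; [lra|]. rewrite A0.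
    assert (E : blk_w k T rho a / Zr * Zr = blk_w k T rho a) by (field; lra).
    assert (X0 : 0 < blk_w k T rho a / Zr) by (apply Rdiv_lt_0_compat; lra).
    set (x := blk_w k T rho a / Zr) in *.
    assert (X1 : x <= 1) by nra.
    unfold overlap. rewrite Rminus_0_r, Rmax_right; [|apply Rmin_glb; lra].
    apply Rmin_glb; [rewrite <- E, Rmult_comm; apply Rmult_le_compat_l; lra|nra].
  - apply (sumd_ge_term d (fun i => blk_h k T rho i *
      overlap (blk_start k T d rho i) (blk_w k T rho i) l)); auto.
    intros i Hi. apply Rmult_le_pos; [eapply blk_h_ge0; eauto|].
    apply overlap_bounds, blk_w_ge0. }
assert (Hbd : bound P).
(* At [l = c / (2 * Hgr)] the curve of rho is at most [c / 2], whereas a larger [m] would push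
   [l * m] past [Zs], where sigma contributes the full [c]. *)
{ exists (Zs / (c / (2 * Hgr))). intros m [Hm H].
  assert (Hl0 : 0 < c / (2 * Hgr)) by (apply Rdiv_lt_0_compat; lra).
  apply Rnot_lt_le; intro Hlt.
  assert (HZ : Zs <= c / (2 * Hgr) * m).
  { replace Zs with (c / (2 * Hgr) * (Zs / (c / (2 * Hgr)))) by (field; lra).
    apply Rmult_le_compat_l; lra. }
  specialize (H (c / (2 * Hgr)) ltac:(lra)).
  rewrite lorenz_full in H by auto.
  assert (L := lorenz_le_linear k T d rho (c / (2 * Hgr)) Hr ltac:(lra)). fold Hgr in L.
  replace (Hgr * (c / (2 * Hgr))) with (c / 2) in L by (field; lra). lra. }
destruct (completeness P Hbd Hne) as [M [HMub HMl]].
assert (HM : 0 < M) by (destruct Hne as [m Hm]; specialize (HMub m Hm); destruct Hm; lra).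
exists M. split; [auto|]. split.
2: { intros m Hm H. apply HMub. split; [auto|]. apply MixCond_lorenz; auto; lra. }
apply MixCond_lorenz; [lra|lra|]. intros l Hl. apply Rnot_lt_le; intro Hlt.
set (gap := c * lorenz k T d sigma (l * M) - lorenz k T d rho l).
assert (Hgap : 0 < gap) by (unfold gap; lra).
assert (Hgl : 0 < Hgs * l + 1) by nra.
(* Moving from [M] to an admissible [m > M - e] changes the left side by at most [Hgs * l * e]; the
   [+ 1] keeps this strictly below [gap]. *)
set (e := gap / (Hgs * l + 1)).
assert (Ee : e * (Hgs * l + 1) = gap) by (unfold e; field; lra).
assert (He : 0 < e) by (apply Rdiv_lt_0_compat; auto).
assert (Hm : exists m, P m /\ M - e < m).
{ apply NNPP; intro Hno. assert (M <= M - e); [|lra]. apply HMl. intros m Pm.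
  apply Rnot_lt_le; intro. apply Hno; exists m; auto. }
destruct Hm as [m [[Hm HP] Hme]].
assert (HmM : m <= M) by (apply HMub; split; auto).
specialize (HP l Hl).
assert (Hlm : l * m <= l * M) by nra.
assert (L := lorenz_lipschitz k T d sigma (l * m) (l * M) Hs Hlm). fold Hgs in L.
assert (Hb1 : Hgs * (l * M - l * m) <= Hgs * l * e).
{ replace (Hgs * (l * M - l * m)) with (Hgs * l * (M - m)) by ring.
  apply Rmult_le_compat_l; nra. }
assert (Hb2 : c * (lorenz k T d sigma (l * M) - lorenz k T d sigma (l * m)) <= Hgs * l * e).
{ assert (0 <= Hgs * l * e) by (apply Rmult_le_pos; nra).
  apply Rle_trans with (c * (Hgs * l * e)); [apply Rmult_le_compat_l; lra|nra]. }
unfold gap in Ee. nra.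
Qed.

(** * Relabelling the levels *)

(** The involution for the tails fixes both heads, so it can be combined with the transposition of
    the heads. *)
Lemma matching_involution (l1 l2 : list nat) :
  NoDup l1 -> NoDup l2 -> (forall x, In x l1 -> ~ In x l2) -> (length l1 <= length l2)%nat ->
  exists pi : nat -> nat,
    (forall x, pi (pi x) = x) /\ (forall x, In x l1 -> In (pi x) l2) /\
    (forall x, ~ In x l1 -> ~ In x l2 -> pi x = x).
Proof.
revert l2. induction l1 as [|x1 l1 IH]; intros l2 N1 N2 Hdis Hlen.
{ exists (fun x => x). split; [auto|split; [intros ? []|auto]]. }
destruct l2 as [|x2 l2]; [simpl in Hlen; lia|].
inversion N1 as [|? ? M1 N1']; subst. inversion N2 as [|? ? M2 N2']; subst.
destruct (IH l2) as [pi [Hinv [H12 Hfix]]]; auto; [|simpl in Hlen; lia|].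
{ intros x H1 H2. apply (Hdis x); simpl; auto. }
assert (F1 : pi x1 = x1) by (apply Hfix; auto; intro; apply (Hdis x1); simpl; auto).
assert (F2 : pi x2 = x2) by (apply Hfix; auto; intro; apply (Hdis x2); simpl; auto).
assert (Hne : forall x y, pi y = y -> x <> y -> pi x <> y) by (intros x y E Hxy E'; congruence).
exists (fun x => if Nat.eqb x x1 then x2 else if Nat.eqb x x2 then x1 else pi x).
split; [|split].
- intro x. destruct (Nat.eqb_spec x x1) as [->|E1].
  + rewrite Nat.eqb_refl. destruct (Nat.eqb_spec x2 x1); auto.
  + destruct (Nat.eqb_spec x x2) as [->|E2]; [rewrite Nat.eqb_refl; auto|].
    rewrite (proj2 (Nat.eqb_neq _ _) (Hne x x1 F1 E1)),
            (proj2 (Nat.eqb_neq _ _) (Hne x x2 F2 E2)). auto.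
- intros x Hx. destruct (Nat.eqb_spec x x1) as [->|E1]; [simpl; auto|].
  destruct Hx as [Hx|Hx]; [congruence|].
  destruct (Nat.eqb_spec x x2) as [->|E2]; [exfalso; apply (Hdis x2); simpl; auto|].
  right; auto.
- intros x H1 H2. simpl in H1, H2.
  destruct (Nat.eqb_spec x x1) as [->|E1]; [tauto|].
  destruct (Nat.eqb_spec x x2) as [->|E2]; [tauto|]. apply Hfix; tauto.
Qed.

Lemma filter_count (A : Type) (p q : A -> bool) (l : list A) :
  (length (filter (fun x => (p x && q x)%bool) l) + length l =
   length (filter p l) + length (filter q l) +
   length (filter (fun x => (negb (p x) && negb (q x))%bool) l))%nat.
Proof.
induction l as [|x l IH]; [reflexivity|]. simpl.
destruct (p x), (q x); simpl; lia.
Qed.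

Definition infinite (e : option R) : bool := match e with None => true | Some _ => false end.

Lemma count_infinite d m s : AtLeastInfLevels d m s ->
  (m <= length (filter (fun i => infinite (En s i)) (seq 0 d)))%nat.
Proof.
intros [l [Hnd [Hm Hl]]]. eapply Nat.le_trans; [exact Hm|].
apply NoDup_incl_length; auto. intros i Hi. destruct (Hl i Hi) as [Hd [E _]].
apply filter_In. split; [apply in_seq; lia|now rewrite E].
Qed.

(** [pi] swaps common finite levels with common infinite ones and fixes all others. The last clause
    ensures that copying the energies of rho to the images under [pi], as in [parked], overwrites no
    finite energy by a different one. *)
Lemma relabelling n rho sigma :
  AtLeastInfLevels (2 * n + 1) (n + 1) rho -> AtLeastInfLevels (2 * n + 1) (n + 1) sigma ->
  exists pi : nat -> nat,
    (forall i, pi (pi i) = i) /\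
    (forall i, (i < 2 * n + 1)%nat -> (pi i < 2 * n + 1)%nat) /\
    (forall i, (i < 2 * n + 1)%nat -> En rho i <> None -> En sigma (pi i) = None) /\
    (forall i, (i < 2 * n + 1)%nat -> En rho i <> None -> En rho (pi i) <> None -> pi i = i).
Proof.
intros Hr Hs. set (d := (2 * n + 1)%nat) in *.
set (p := fun i => infinite (En rho i)). set (q := fun i => infinite (En sigma i)).
set (l1 := filter (fun i => (negb (p i) && negb (q i))%bool) (seq 0 d)).
set (l2 := filter (fun i => (p i && q i)%bool) (seq 0 d)).
assert (In1 : forall i, In i l1 <-> (i < d)%nat /\ En rho i <> None /\ En sigma i <> None).
{ intro i. unfold l1. rewrite filter_In, in_seq. unfold p, q, infinite.
  destruct (En rho i), (En sigma i); simpl; intuition (lia || congruence). }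
assert (In2 : forall i, In i l2 <-> (i < d)%nat /\ En rho i = None /\ En sigma i = None).
{ intro i. unfold l2. rewrite filter_In, in_seq. unfold p, q, infinite.
  destruct (En rho i), (En sigma i); simpl; intuition (lia || congruence). }
destruct (matching_involution l1 l2) as [pi [Hinv [H12 Hfix]]].
- apply NoDup_filter, seq_NoDup.
- apply NoDup_filter, seq_NoDup.
- intros i. rewrite In1, In2. tauto.
(* By inclusion-exclusion the common infinite levels outnumber the common finite ones by at least
   [2 * (n + 1) - (2 * n + 1) = 1]. *)
- assert (C := filter_count nat p q (seq 0 d)). fold l1 l2 in C. rewrite length_seq in C.
  apply count_infinite in Hr. apply count_infinite in Hs. fold p in Hr. fold q in Hs.
  unfold d in *. lia.
- exists pi. split; [auto|]. split; [|split].
  + intros i Hi. destruct (lt_dec (pi i) d) as [|Hge]; [auto|].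
    assert (E : pi (pi i) = pi i) by (apply Hfix; rewrite ?In1, ?In2; tauto).
    rewrite Hinv in E. lia.
  + intros i Hi Ei. destruct (classic (En sigma i = None)) as [E|E].
    * rewrite Hfix; auto; rewrite ?In1, ?In2; tauto.
    * apply In2, H12, In1. auto.
  + intros i Hi Ei Epi. destruct (classic (En sigma i = None)) as [E|E].
    * apply Hfix; rewrite ?In1, ?In2; tauto.
    * exfalso. apply Epi. apply In2, H12, In1. auto.
Qed.

(** * The protocol *)

Definition expect (outs : list Outcome) (phi : nat -> option R -> R) : R :=
  fold_right Rplus 0 (map (fun o => o_p o * phi (o_lvl o) (o_w o)) outs).

Lemma expect_app o1 o2 phi : expect (o1 ++ o2) phi = expect o1 phi + expect o2 phi.
Proof.
unfold expect. induction o1 as [|o o1 IH]; simpl; [ring|]. rewrite IH. ring.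
Qed.

(** Backward evolution of a test function (Heisenberg picture): its mean after the step, as a
    function of level and work before it. A run is thus evaluated without enumerating outcomes. *)
Definition pull (d : nat) (E : Energies) (st : Step) (phi : nat -> option R -> R)
  (j : nat) (w : option R) : R :=
  match st with
  | Therm B => sumd d (fun i => B i j * phi i w)
  | EChange A E' => phi j (if A j then addw w (work_of (E j) (E' j)) else w)
  end.

Lemma expect_step d E st outs phi :
  expect (flat_map (step_out d E st) outs) phi = expect outs (pull d E st phi).
Proof.
induction outs as [|o outs IH]; [reflexivity|].
cbn [flat_map]. rewrite expect_app, IH. unfold expect at 3. cbn [map fold_right].
fold (expect outs (pull d E st phi)). f_equal.
destruct st as [B|A E']; unfold expect; cbn [step_out map fold_right pull o_p o_lvl o_w];
  [|ring].
rewrite <- sumd_scal. unfold sumd. rewrite map_map. f_equal. apply map_ext.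
intro i. simpl. ring.
Qed.

Lemma expect_init d s phi :
  expect (init_outs d s) phi = sumd d (fun i => lam s i * phi i (Some 0)).
Proof. unfold expect, init_outs, sumd. now rewrite map_map. Qed.

Lemma prob_event_expect outs thr :
  prob_event outs thr = expect outs (fun _ w => if in_event thr w then 1 else 0).
Proof.
unfold prob_event, expect. f_equal. apply map_ext. intro o.
destruct (in_event thr (o_w o)); ring.
Qed.

Lemma prob_event_lvl_expect outs thr i :
  prob_event_lvl outs thr i =
  expect outs (fun j w => if in_event thr w then if Nat.eqb j i then 1 else 0 else 0).
Proof.
unfold prob_event_lvl, expect. f_equal. apply map_ext. intro o.
destruct (in_event thr (o_w o)), (Nat.eqb (o_lvl o) i); simpl; ring.
Qed.

Lemma gibbs_preserving k T d E (B : nat -> nat -> R) i :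
  sumd d (fun j => B i j * boltz k T (E j)) = boltz k T (E i) ->
  sumd d (fun j => B i j * gibbs_vec k T d E j) = gibbs_vec k T d E i.
Proof.
intro H. unfold gibbs_vec. set (Z := sumd d (fun j => boltz k T (E j))).
rewrite (sumd_ext d _ (fun j => / Z * (B i j * boltz k T (E j))))
  by (intros; unfold Rdiv; ring).
rewrite sumd_scal, H. unfold Rdiv. ring.
Qed.

Lemma boltz_shift k T x M : 0 < k -> 0 < T -> 0 < M ->
  boltz k T (Some (x + k * T * ln M)) = boltz k T (Some x) / M.
Proof.
intros Hk HT HM. unfold boltz.
replace (- (x + k * T * ln M) / (k * T)) with (- x / (k * T) + - ln M) by (field; lra).
rewrite exp_plus, exp_Ropp, exp_ln by auto. reflexivity.
Qed.

(** Relabelling by [pi] only permutes the hinge sums, so domination survives and a plan exists.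
    Raising sigma by kT ln M divides widths by [M]; the target heights [c * M * blk_h] therefore
    carry the masses [c * lam sigma i]. *)
Lemma conversion_matrix k T d rho sigma (pi : nat -> nat) c M :
  IsState d rho -> IsState d sigma ->
  0 < c -> 0 < M ->
  (forall i, pi (pi i) = i) -> (forall i, (i < d)%nat -> (pi i < d)%nat) ->
  (forall i, (i < d)%nat -> En rho i <> None -> En sigma (pi i) = None) ->
  (forall l, 0 <= l -> c * lorenz k T d sigma (l * M) <= lorenz k T d rho l) ->
  exists B : nat -> nat -> R,
    (forall i j, (i < d)%nat -> (j < d)%nat -> 0 <= B i j) /\
    (forall j, (j < d)%nat -> sumd d (fun i => B i j) = 1) /\
    (forall i, (i < d)%nat ->
       sumd d (fun j => B i j * (blk_w k T rho (pi j) + blk_w k T sigma j / M)) =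
       blk_w k T rho (pi i) + blk_w k T sigma i / M) /\
    (forall i, (i < d)%nat -> En sigma i <> None ->
       sumd d (fun j => B i (pi j) * lam rho j) = c * lam sigma i).
Proof.
intros Hr Hs Hc HM Hinv Hlt Hdis HL.
set (u := fun j => blk_w k T rho (pi j)). set (h := fun j => blk_h k T rho (pi j)).
set (v := fun i => blk_w k T sigma i / M). set (g := fun i => c * M * blk_h k T sigma i).
assert (Hu : forall j, (j < d)%nat -> 0 <= u j) by (intros; apply blk_w_ge0).
assert (Hv : forall j, (j < d)%nat -> 0 <= v j)
  by (intros; apply Rdiv_le_0_compat; auto; apply blk_w_ge0).
assert (Hg : forall j, (j < d)%nat -> 0 <= g j).
{ intros j Hj. apply Rmult_le_pos; [nra|eapply blk_h_ge0; eauto]. }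
assert (Hh : forall j, (j < d)%nat -> 0 <= h j)
  by (intros j Hj; eapply blk_h_ge0; eauto).
assert (Hvpos : forall i, En sigma i <> None -> 0 < v i).
{ intros i Ei. apply Rdiv_lt_0_compat; auto. unfold blk_w, boltz.
  destruct (En sigma i); [apply exp_pos|congruence]. }
destruct (transport_plan d v g u h) as [K [K0 [Ku [Kv Kh]]]]; auto.
{ intros s Hs0. eapply Rle_trans;
    [apply (dominated_of_lorenz k T d rho sigma c M Hs Hc HM HL s Hs0)|].
  apply Req_le. symmetry. unfold u, h.
  apply (sumd_invol d pi (fun j => blk_w k T rho j * ppart (blk_h k T rho j - s))); auto. }
destruct (gibbs_stochastic_of_plan d u v h (fun i => c * lam sigma i) K)
  as [B [B0 [B1 [Bw Bq]]]]; auto.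
- intros i Hi. destruct (classic (En rho (pi i) = None)) as [E|E].
  + left. unfold u, blk_w. now rewrite E.
  + right. apply Hdis in E; auto. rewrite Hinv in E. unfold v, blk_w. rewrite E.
    simpl. unfold Rdiv; ring.
- destruct Hs as [_ [_ [_ [i [Hi Ei]]]]]. apply Rlt_le_trans with (v i); auto.
  apply (sumd_ge_term d v); auto.
- intros i Hi. rewrite Kh by auto. rewrite <- (blk_area k T d sigma i) by auto.
  unfold v, g. field; lra.
- exists B. split; [auto|split; [auto|split; [auto|]]].
  intros i Hi Ei. rewrite <- Bq; auto.
  rewrite <- (sumd_invol d pi (fun j => B i j * (u j * h j))) by auto.
  apply sumd_ext; intros j Hj. unfold u, h. rewrite Hinv, (blk_area k T d rho j) by auto. ring.
Qed.

Lemma permutation_step_valid k T d E (pi : nat -> nat) :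
  (forall i, pi (pi i) = i) -> (forall i, (i < d)%nat -> (pi i < d)%nat) ->
  (forall i, (i < d)%nat -> E (pi i) = E i) ->
  valid_step k T d E (Therm (fun i j => if Nat.eqb i (pi j) then 1 else 0)).
Proof.
intros Hinv Hlt HE. split; [|split].
- intros i j _ _. destruct Nat.eqb; lra.
- intros j Hj. apply (sumd_delta d (pi j) (fun _ => 1)); auto.
- intros i Hi. apply (gibbs_preserving k T d E (fun i j => if Nat.eqb i (pi j) then 1 else 0)).
  cbv beta. rewrite <- HE by auto.
  rewrite <- (sumd_delta d (pi i) (fun j => boltz k T (E j))) by auto.
  apply sumd_ext; intros j Hj.
  replace (Nat.eqb i (pi j)) with (Nat.eqb j (pi i)); [destruct Nat.eqb; ring|].
  apply Bool.eq_iff_eq_true. rewrite !Nat.eqb_eq. split; intros ->; now rewrite Hinv.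
Qed.

(* [parked]: the levels of rho, doubled onto their images under pi.  [loaded]: the
   levels of sigma raised by kT ln M, those of rho now sitting at their images. *)
Definition parked (rho : State) (pi : nat -> nat) : Energies :=
  fun i => match En rho i with Some x => Some x | None => En rho (pi i) end.

Definition loaded (rho sigma : State) (pi : nat -> nat) (W : R) : Energies :=
  fun i => match En sigma i with Some x => Some (x + W) | None => En rho (pi i) end.

(** The first two energy changes leave the energy of every level with positive occupation
    probability unchanged. Only the last one exchanges work. *)
Definition protocol (rho sigma : State) (pi : nat -> nat) (W : R) (B : nat -> nat -> R)
  : list Step :=
  EChange (fun _ => true) (parked rho pi) ::
  Therm (fun i j => if Nat.eqb i (pi j) then 1 else 0) ::
  EChange (fun _ => true) (loaded rho sigma pi W) ::
  Therm B ::
  EChange (fun _ => true) (En sigma) :: nil.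

Lemma parked_image rho pi i :
  (En rho i <> None -> En rho (pi i) <> None -> pi i = i) ->
  pi (pi i) = i -> En rho i <> None -> parked rho pi (pi i) = En rho i.
Proof.
intros Hfix Hinv Ei. unfold parked. destruct (En rho (pi i)) eqn:E; [|now rewrite Hinv].
rewrite <- E. rewrite Hfix; congruence.
Qed.

(** With positive probability the total work is only ever [W], on final levels finite for sigma, or
    minus infinity, on the others. So for [thr <= W] the event says exactly that the final level is
    finite for sigma. *)
Lemma expect_protocol d rho sigma pi W B thr psi :
  (forall i, (i < d)%nat -> En rho i = None -> lam rho i = 0) ->
  (forall i, pi (pi i) = i) -> (forall i, (i < d)%nat -> (pi i < d)%nat) ->
  (forall i, (i < d)%nat -> En rho i <> None -> En sigma (pi i) = None) ->
  (forall i, (i < d)%nat -> En rho i <> None -> En rho (pi i) <> None -> pi i = i) ->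
  thr <= W ->
  expect (run d (En rho) (init_outs d rho) (protocol rho sigma pi W B))
    (fun i w => if in_event thr w then psi i else 0) =
  sumd d (fun i => (if infinite (En sigma i) then 0 else psi i) *
                   sumd d (fun j => B i (pi j) * lam rho j)).
Proof.
intros Hlam Hinv Hlt Hdis Hfix Hthr.
unfold protocol. cbn [run]. rewrite !expect_step, expect_init.
transitivity (sumd d (fun j => sumd d (fun i =>
  lam rho j * (B i (pi j) * (if infinite (En sigma i) then 0 else psi i))))).
2: { rewrite sumd_exch. apply sumd_ext; intros i _. rewrite <- sumd_scal.
     apply sumd_ext; intros j _. ring. }
apply sumd_ext; intros j Hj. rewrite sumd_scal.
destruct (classic (En rho j = None)) as [Ej|Ej]; [rewrite Hlam by auto; ring|].
f_equal. unfold pull at 1 2. cbn [apply_E].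
assert (Pj := parked_image rho pi j (Hfix j Hj) (Hinv j) Ej).
assert (Lj : loaded rho sigma pi W (pi j) = En rho j)
  by (unfold loaded; rewrite Hdis, Hinv by auto; reflexivity).
assert (Pj' : parked rho pi j = En rho j)
  by (unfold parked; destruct (En rho j); [reflexivity|congruence]).
rewrite (sumd_ext d _ (fun i => if Nat.eqb i (pi j) then
  pull d (parked rho pi) (EChange (fun _ => true) (loaded rho sigma pi W))
    (pull d (loaded rho sigma pi W) (Therm B)
      (pull d (loaded rho sigma pi W) (EChange (fun _ => true) (En sigma))
         (fun i w => if in_event thr w then psi i else 0))) i
    (addw (Some 0) (work_of (En rho j) (parked rho pi j))) else 0)).
2: { intros i _. destruct Nat.eqb; [apply Rmult_1_l|apply Rmult_0_l]. }
rewrite (sumd_delta d (pi j)) by auto.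
cbn [pull]. rewrite Pj, Lj, Pj'.
destruct (En rho j) as [x|]; [|congruence]. cbn [work_of addw].
apply sumd_ext; intros i Hi. f_equal.
unfold loaded. destruct (En sigma i) as [y|] eqn:Ei; cbn [work_of addw infinite].
- unfold in_event. destruct Rle_dec; [auto|lra].
- destruct (En rho (pi i)); reflexivity.
Qed.

Lemma protocol_valid k T d rho sigma pi M B :
  0 < k -> 0 < T -> 0 < M ->
  (forall i, pi (pi i) = i) -> (forall i, (i < d)%nat -> (pi i < d)%nat) ->
  (forall i, (i < d)%nat -> En rho i <> None -> En sigma (pi i) = None) ->
  (forall i, (i < d)%nat -> En rho i <> None -> En rho (pi i) <> None -> pi i = i) ->
  (forall i j, (i < d)%nat -> (j < d)%nat -> 0 <= B i j) ->
  (forall j, (j < d)%nat -> sumd d (fun i => B i j) = 1) ->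
  (forall i, (i < d)%nat ->
     sumd d (fun j => B i j * (blk_w k T rho (pi j) + blk_w k T sigma j / M)) =
     blk_w k T rho (pi i) + blk_w k T sigma i / M) ->
  ValidStrategy k T d (En rho) (protocol rho sigma pi (k * T * ln M) B).
Proof.
intros Hk HT HM Hinv Hlt Hdis Hfix B0 B1 Bw.
(* At most one summand is nonzero, by disjointness of the relabelled supports. This identifies the
   weights preserved by [B] with the Boltzmann weights of the loaded energies. *)
assert (HE : forall i, (i < d)%nat -> boltz k T (loaded rho sigma pi (k * T * ln M) i) =
  blk_w k T rho (pi i) + blk_w k T sigma i / M).
{ intros i Hi. unfold loaded, blk_w. destruct (En sigma i) as [x|] eqn:Ei.
  - rewrite boltz_shift by auto.
    destruct (classic (En rho (pi i) = None)) as [->|E]; [cbn [boltz]; ring|].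
    apply Hdis in E; auto. rewrite Hinv in E. congruence.
  - cbn [boltz]. unfold Rdiv. ring. }
unfold protocol. cbn [ValidStrategy apply_E]. split; [exact I|]. split.
{ apply permutation_step_valid; auto. intros i Hi.
  destruct (classic (En rho i = None)) as [E|E].
  - unfold parked at 2. rewrite E. destruct (classic (En rho (pi i) = None)) as [E'|E'].
    + unfold parked. now rewrite E', Hinv.
    + unfold parked. destruct (En rho (pi i)); [reflexivity|congruence].
  - rewrite parked_image; auto. unfold parked. destruct (En rho i); [reflexivity|congruence]. }
split; [exact I|]. split; [|split; exact I].
split; [auto|split; [auto|]]. intros i Hi. apply gibbs_preserving.
rewrite HE by auto. rewrite <- Bw by auto. apply sumd_ext; intros j Hj. now rewrite HE.
Qed.

Theorem theorem1 (k T : R) (hk : 0 < k) (hT : 0 < T) (n : nat)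
  (rho sigma : State)
  (hrho : IsState (2 * n + 1) rho) (hsigma : IsState (2 * n + 1) sigma)
  (hrho_inf : AtLeastInfLevels (2 * n + 1) (n + 1) rho)
  (hsigma_inf : AtLeastInfLevels (2 * n + 1) (n + 1) sigma)
  (eps : R) (heps : 0 <= eps < 1) :
  exists M : R,
    IsRelMix (fun x => GibbsResc k T (2 * n + 1) rho x / (1 - eps))
             (GibbsResc k T (2 * n + 1) sigma) M /\
    forall delta : R, 0 < delta ->
      exists strat : list Step,
        ValidStrategy k T (2 * n + 1) (En rho) strat /\
        (forall i, (i < 2 * n + 1)%nat -> final_E (En rho) strat i = En sigma i) /\
        (let outs := run (2 * n + 1) (En rho) (init_outs (2 * n + 1) rho) strat in
         let thr := k * T * ln M - delta in
         prob_event outs thr >= 1 - eps - delta /\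
         (0 < prob_event outs thr ->
            cond_TV (2 * n + 1) outs thr (lam sigma) <= delta)).
Proof.
destruct (relabelling n rho sigma hrho_inf hsigma_inf) as [pi [Hinv [Hlt [Hdis Hfix]]]].
set (d := (2 * n + 1)%nat) in *. set (c := 1 - eps).
assert (Hc : 0 < c <= 1) by (unfold c; lra).
destruct (relmix_exists k T d rho sigma c hrho hsigma Hc) as [M HM].
exists M. split; [exact HM|]. intros delta Hdelta.
destruct HM as [HM [HL _]].
rewrite (MixCond_lorenz k T d rho sigma c M) in HL by lra.
destruct (conversion_matrix k T d rho sigma pi c M) as [B [B0 [B1 [Bw Bq]]]]; auto; [lra|].
exists (protocol rho sigma pi (k * T * ln M) B).
split; [apply protocol_valid; auto|]. split; [reflexivity|].
intros outs thr.
(* The constant [psi = 1] gives the probability of the event, an indicator gives the joint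
   probability with a final level. Their ratio is [lam sigma] exactly. *)
assert (Hex : forall psi, expect outs (fun i w => if in_event thr w then psi i else 0) =
  c * sumd d (fun i => lam sigma i * psi i)).
{ intro psi. unfold outs. rewrite expect_protocol; auto; [|apply hrho|unfold thr; lra].
  rewrite <- sumd_scal. apply sumd_ext; intros i Hi.
  assert (L := proj1 (proj2 (proj2 hsigma)) i Hi). specialize (Bq i Hi).
  destruct (En sigma i); cbn [infinite].
  - rewrite Bq by congruence. ring.
  - rewrite L by auto. ring. }
assert (Hp : prob_event outs thr = c).
{ rewrite prob_event_expect, (Hex (fun _ => 1)), (sumd_ext d _ (lam sigma)) by (intros; ring).
  rewrite (proj1 (proj2 hsigma)). ring. }
assert (Hl : forall i, (i < d)%nat -> prob_event_lvl outs thr i = c * lam sigma i).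
{ intros i Hi. rewrite prob_event_lvl_expect, (Hex (fun j => if Nat.eqb j i then 1 else 0)).
  f_equal. rewrite <- (sumd_delta d i (lam sigma)) by auto.
  apply sumd_ext; intros j _. destruct Nat.eqb; ring. }
split; [rewrite Hp; unfold c; lra|]. intros _. unfold cond_TV.
rewrite sumd_eq0; [lra|]. intros i Hi. rewrite Hl, Hp by auto.
replace (c * lam sigma i / c - lam sigma i) with 0 by (field; lra). apply Rabs_R0.
Qed.
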